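(* Every sum-rank metric code can be extended to a one-weight code: if $\mathcal{C}$ is a (nondegenerate) $[\mathbf{n},k]_{q^m/q}$ sum-rank metric code, with $\mathbf{n}=(n_1,\ldots,n_t)$, then there exist a generator matrix $(G_1|\cdots|G_t)$ of $\mathcal{C}$, an integer $s\ge t$ and matrices $G_{t+1},\ldots,G_s$ with $k$ rows and entries in $\mathbb{F}_{q^m}$ such that the sum-rank metric code with generator matrix $(G_1|\cdots|G_t|G_{t+1}|\cdots|G_s)$ (with $s$ blocks) is a nondegenerate one-weight code.
   Context: Let $q$ be a prime power and $\mathbf{n}=(n_1,\ldots,n_t)$ a tuple of positive integers (not required to be ordered), $\mathbb{F}_{q^m}^{\mathbf{n}}=\bigoplus_{i=1}^t\mathbb{F}_{q^m}^{n_i}$. The rank of $v\in\mathbb{F}_{q^m}^n$ is the $\mathbb{F}_q$-dimension of the $\mathbb{F}_q$-span of its entries; the sum-rank weight of $x=(x_1,\ldots,x_t)$ is $w(x)=\sum_i\mathrm{rk}(x_i)$. An $[\mathbf{n},k]_{q^m/q}$ code is a $k$-dimensional $\mathbb{F}_{q^m}$-subspace of $\mathbb{F}_{q^m}^{\mathbf{n}}$ with distance $w(x-y)$. A generator matrix is $G=(G_1|\cdots|G_t)$ with $G_i\in\mathbb{F}_{q^m}^{k\times n_i}$ and rows a basis of the code; the code is nondegenerate if the columns of each $G_i$ are $\mathbb{F}_q$-linearly independent. A code is one-weight if all its nonzero codewords have the same sum-rank weight. Extending a code means adding new blocks of columns to a generator matrix. *)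

(* Defs.v *)
From HB Require Import structures.
From mathcomp Require Import all_boot all_order all_algebra all_field.

Set Implicit Arguments.
Unset Strict Implicit.
Unset Printing Implicit Defensive.

Import GRing.Theory.
Local Open Scope ring_scope.

Section SumRank.

(* F and L play the roles of F_q and F_{q^m}: q = #|F| and m = \dim {:L}. *)
Variables (F : finFieldType) (L : fieldExtType F).

Definition rk (n : nat) (v : 'rV[L]_n) : nat :=
  \dim <<[seq v ord0 j | j : 'I_n]>>%VS.

(* The ambient space of type (n_0, ..., n_{t-1}) is the space of row vectors
   of length \sum_i n_i; the i-th component of x is submxrow x i. *)
Section Code.
Variables (t : nat) (n : 'I_t -> nat).
Implicit Types (C : {vspace 'rV[L]_(\sum_(i < t) n i)}).

Definition sumrank_weight (x : 'rV[L]_(\sum_(i < t) n i)) : nat :=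
  (\sum_(i < t) rk (submxrow x i))%N.

Definition generator_matrix C (k : nat) (G : 'M[L]_(k, \sum_(i < t) n i)) :=
  basis_of C [seq row i G | i : 'I_k].

(* 'cV[L]_k is canonically a vector space over L only, so independence of the
   columns over the subfield F is spelled out. *)
Definition columns_free (k p : nat) (A : 'M[L]_(k, p)) : Prop :=
  forall c : 'I_p -> F,
    \sum_(j < p) (c j)%:A *: col j A = 0 -> forall j, c j = 0.

Definition nondegenerate_code C : Prop :=
  exists (k : nat) (G : 'M[L]_(k, \sum_(i < t) n i)),
    generator_matrix C G /\ (forall i, columns_free (submxrow G i)).

Definition one_weight C : Prop :=
  forall x y, x \in C -> y \in C -> x != 0 -> y != 0 ->
    sumrank_weight x = sumrank_weight y.

Lemma generator_matrix_sub C k k' (G : 'M[L]_(k, \sum_(i < t) n i))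
    (H : 'M[L]_(k', \sum_(i < t) n i)) :
  generator_matrix C G -> generator_matrix C H -> exists M, G = M *m H.
Proof.
move=> /andP[/eqP sG _] /andP[/eqP sH _].
suff /submxP : (G <= H)%MS by [].
apply/row_subP => i.
have : row i G \in <<[seq row i H | i : 'I_k']>>%VS.
  by rewrite sH -sG memv_span // codom_f.
move=> /(@coord_span _ _ _ (in_tuple _)) ->.
apply: summx_sub => j _; apply: scalemx_sub.
have : (in_tuple [seq row i H | i : 'I_k'])`_j \in [seq row i H | i : 'I_k'].
  by rewrite mem_nth.
by case/mapP => l _ ->; apply: row_sub.
Qed.

(* Nondegeneracy does not depend on the generator matrix. *)
Lemma nondegenerate_codeP C k (G : 'M[L]_(k, \sum_(i < t) n i)) :
  generator_matrix C G ->
  nondegenerate_code C <-> (forall i, columns_free (submxrow G i)).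
Proof.
move=> gG; split=> [[k' [H [gH nH]]] i c|nG]; last by exists k, G.
have [M eH] := generator_matrix_sub gH gG.
move=> c0; apply: (nH i); rewrite eH.
have -> : submxrow (M *m G) i = M *m submxrow G i.
  by apply/matrixP => a b; rewrite !mxE; apply: eq_bigr => l _; rewrite !mxE.
transitivity (M *m \sum_(j < n i) (c j)%:A *: col j (submxrow G i)).
  rewrite mulmx_sumr; apply: eq_bigr => j _.
  by rewrite -scalemxAr !colE mulmxA.
by rewrite c0 mulmx0.
Qed.

End Code.

Section Extend.
Variables (t r : nat) (n : 'I_t -> nat) (n' : 'I_r -> nat).

(* The concatenated tuple (n_0, ..., n_{t-1}, n'_0, ..., n'_{r-1}). *)
Definition cat_sizes (i : 'I_(t + r)) : nat :=
  match split i with inl j => n j | inr j => n' j end.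

Definition cat_blocks (k : nat) (G : forall j, 'M[L]_(k, n j))
    (G' : forall j, 'M[L]_(k, n' j)) (i : 'I_(t + r)) :
    'M[L]_(k, cat_sizes i) :=
  match split i as u
    return 'M[L]_(k, match u with inl j => n j | inr j => n' j end) with
  | inl j => G j
  | inr j => G' j
  end.

(* (G_0 | ... | G_{t-1} | G'_0 | ... | G'_{r-1}) *)
Definition extend_matrix (k : nat) (G : 'M[L]_(k, \sum_(i < t) n i))
    (G' : forall j, 'M[L]_(k, n' j)) :
    'M[L]_(k, \sum_(i < t + r) cat_sizes i) :=
  \mxrow_(i < t + r) cat_blocks (submxrow G) G' i.

End Extend.
End SumRank.

(* Main.v *)
(** For a nonzero message [x], averaging the weight of [x *m A *m G] over all
    [A] in GL_k(L) gives a value that does not depend on [x], because GL_k(L)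
    is finite and acts transitively on nonzero vectors. Adjoining the blocks
    [A *m G_i] for all [A != 1] in GL_k(L) thus makes the code one-weight, and
    it preserves nondegeneracy because [A] is invertible. *)
Require Import Defs.
From mathcomp Require Import all_boot all_order all_algebra all_field.

Set Implicit Arguments.
Unset Strict Implicit.
Unset Printing Implicit Defensive.

Import GRing.Theory.
Local Open Scope ring_scope.

(** The matrix [pinvmx x *m y] already sends [x] to [y]. Since [x] and [y] both have rank 1,
    [complete_unitmx] replaces it by an invertible matrix with the same value at [x]. *)
Lemma unitmx_transitive (K : fieldType) k (x y : 'rV[K]_k) :
  x != 0 -> y != 0 -> exists2 B, B \in unitmx & y = x *m B.
Proof.
move=> x0 y0.
have xf : x *m (pinvmx x *m y) = y.
  by rewrite mulmxA mulmxVp ?mul1mx // /row_free rank_rV x0.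
have [|B uB eB] := @complete_unitmx _ _ _ x (pinvmx x *m y).
  by rewrite xf !rank_rV x0 y0.
by exists B; rewrite // -eB.
Qed.

Lemma free_rows (K : fieldType) k p (G : 'M[K]_(k, p)) :
  reflect (forall u : 'rV_k, u *m G = 0 -> u = 0) (free [seq row i G | i : 'I_k]).
Proof.
have nthE (i : 'I_k) : [tuple row i G | i < k]`_i = row i G by rewrite -tnth_nth tnth_mktuple.
apply: (iffP (@freeP _ _ _ [tuple row i G | i < k])) => [fG u uG | fG c c0 i].
  apply/rowP => i; rewrite mxE; apply: fG i.
  by rewrite -[RHS]uG mulmx_sum_row; apply: eq_bigr => i _; rewrite nthE.
have /fG/rowP/(_ i) : \row_i c i *m G = 0; last by rewrite !mxE.
by rewrite -[RHS]c0 mulmx_sum_row; apply: eq_bigr => j _; rewrite nthE mxE.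
Qed.

Lemma span_rowsP (K : fieldType) k p (G : 'M[K]_(k, p)) x :
  x \in <<[seq row i G | i : 'I_k]>>%VS -> exists u, x = u *m G.
Proof.
move/(@coord_span _ _ _ [tuple row i G | i < k]) => {1}->.
exists (\row_i coord [tuple row i G | i < k] i x).
rewrite mulmx_sum_row; apply: eq_bigr => i _.
by rewrite -tnth_nth tnth_mktuple mxE.
Qed.

Section SumRankExtension.
Variables (F : finFieldType) (L : fieldExtType F).

Lemma generator_matrix_exists t (n : 'I_t -> nat)
    (C : {vspace 'rV[L]_(\sum_(i < t) n i)}) :
  exists G : 'M[L]_(\dim C, \sum_(i < t) n i), generator_matrix C G.
Proof.
exists (\matrix_(i, j) tnth (vbasis C) i ord0 j); rewrite /generator_matrix.
suff -> : [seq row i (\matrix_(i, j) tnth (vbasis C) i ord0 j) | i : 'I_(\dim C)]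
            = vbasis C by exact: vbasisP.
rewrite -[RHS]map_tnth_enum; apply: eq_map => i.
by apply/rowP => j; rewrite !mxE.
Qed.

Lemma columns_free_mul k p (A : 'M[L]_k) (M : 'M[L]_(k, p)) :
  A \in unitmx -> columns_free M -> columns_free (A *m M).
Proof.
move=> uA fM c c0; apply: fM; rewrite -[LHS](mulKmx uA).
rewrite -[RHS](mulmx0 _ (invmx A)) -[in RHS]c0 mulmx_sumr; congr (_ *m _).
by apply: eq_bigr => j _; rewrite -scalemxAr !colE mulmxA.
Qed.

(** [L] is finite because it has finite dimension over the finite field [F]; [finvect_type L] is the
    same carrier with its [finType] structure. Passing to a list keeps that alias out of later
    statements. *)
Lemma all_matrices k : exists2 s : seq 'M[L]_k, uniq s & forall A, A \in s.
Proof.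
exists (enum {: 'M[finvect_type L]_k}); first exact: enum_uniq.
exact: (@mem_enum _ {: 'M[finvect_type L]_k}).
Qed.

Lemma all_units k :
  exists2 s : seq 'M[L]_k, uniq s & forall A, (A \in s) = (A \in unitmx).
Proof.
have [s us ms] := all_matrices k.
exists [seq A <- s | A \in unitmx]; first exact: filter_uniq.
by move=> A; rewrite mem_filter ms andbT.
Qed.

Lemma sum_units_const k (s : seq 'M[L]_k) (f : 'rV[L]_k -> nat) x y :
  uniq s -> (forall A, (A \in s) = (A \in unitmx)) -> x != 0 -> y != 0 ->
  (\sum_(A <- s) f (x *m A) = \sum_(A <- s) f (y *m A))%N.
Proof.
move=> us ms x0 y0; have [B uB ->] := unitmx_transitive x0 y0.
under [RHS]eq_bigr do rewrite -mulmxA.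
(* With [y = x *m B], left multiplication by [B] permutes the list of units, so the two sums differ
   only in the order of their terms. *)
rewrite -(big_map (mulmx B) xpredT (fun A => f (x *m A))); apply: perm_big.
apply: uniq_perm => // [|A].
  by rewrite map_inj_uniq //; apply: can_inj (mulKmx uB).
rewrite ms; apply/idP/mapP => [uA | [A']]; last first.
  by rewrite ms => uA' ->; rewrite unitmx_mul uB.
by exists (invmx B *m A); rewrite ?mulKVmx // ms unitmx_mul unitmx_inv uB.
Qed.

Section Blocks.
Variables (t r : nat) (n : 'I_t -> nat) (n' : 'I_r -> nat) (k : nat).
Variables (G : forall j, 'M[L]_(k, n j)) (G' : forall j, 'M[L]_(k, n' j)).

(** The width of a block depends on [split i]; letting [P] range over all widths makes the case
    analysis on [split] well typed. *)
Lemma cat_blocks_ind (P : forall p, 'M[L]_(k, p) -> Prop) :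
  (forall j, P _ (G j)) -> (forall j, P _ (G' j)) ->
  forall i, P _ (cat_blocks G G' i).
Proof. by move=> PG PG' i; rewrite /cat_blocks /cat_sizes; case: split. Qed.

(** The two blocks have widths that are equal but not convertible, so they are compared through a
    function [f] defined for every width. *)
Lemma cat_blocks_lshift T (f : forall p, 'M[L]_(k, p) -> T) j :
  f _ (cat_blocks G G' (lshift r j)) = f _ (G j).
Proof. by rewrite /cat_blocks /cat_sizes (unsplitK (inl _ j)). Qed.

Lemma cat_blocks_rshift T (f : forall p, 'M[L]_(k, p) -> T) j :
  f _ (cat_blocks G G' (rshift t j)) = f _ (G' j).
Proof. by rewrite /cat_blocks /cat_sizes (unsplitK (inr _ j)). Qed.

End Blocks.

Lemma submxrow_mul k l t (n : 'I_t -> nat) (u : 'M[L]_(l, k))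
    (G : 'M[L]_(k, \sum_(i < t) n i)) i :
  submxrow (u *m G) i = u *m submxrow G i.
Proof. by apply/matrixP => a b; rewrite !mxE; apply: eq_bigr => j _; rewrite mxE. Qed.

Lemma sumrank_weight_extend t r (n : 'I_t -> nat) (n' : 'I_r -> nat) k
    (G : 'M[L]_(k, \sum_(i < t) n i)) (G' : forall j, 'M[L]_(k, n' j)) u :
  sumrank_weight (u *m extend_matrix G G') =
  (\sum_(i < t) rk (u *m submxrow G i) + \sum_(j < r) rk (u *m G' j))%N.
Proof.
rewrite /sumrank_weight big_split_ord /=.
congr (_ + _)%N; apply: eq_bigr => j _; rewrite submxrow_mul mxrowK.
  exact: (cat_blocks_lshift _ _ (fun p M => rk (u *m M))).
exact: (cat_blocks_rshift _ _ (fun p M => rk (u *m M))).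
Qed.

(** The first [t] blocks of the extended codeword are those of [u *m G]. Hence linear independence
    of the rows of [G] passes to the extension. *)
Lemma extend_matrix_eq0 t r (n : 'I_t -> nat) (n' : 'I_r -> nat) k
    (G : 'M[L]_(k, \sum_(i < t) n i)) (G' : forall j, 'M[L]_(k, n' j))
    (u : 'rV_k) :
  u *m extend_matrix G G' = 0 -> u *m G = 0.
Proof.
move=> u0; rewrite -[LHS]submxrowK -[RHS]submxrowK.
apply/eq_mxrow => i; rewrite submxrow_mul submxrow0; apply/eqP.
rewrite -(cat_blocks_lshift _ G' (fun p M => u *m M == 0)).
by rewrite -[cat_blocks _ _ _](mxrowK (cat_blocks _ _)) -submxrow_mul [_ *m _]u0 submxrow0.
Qed.

End SumRankExtension.

Theorem theorem4p12 (F : finFieldType) (L : fieldExtType F)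
    (t : nat) (n : 'I_t -> nat) (n_gt0 : forall i, (0 < n i)%N) (k : nat)
    (C : {vspace 'rV[L]_(\sum_(i < t) n i)})
    (dimC : \dim C = k) (ndC : nondegenerate_code C) :
  exists G : 'M[L]_(k, \sum_(i < t) n i), generator_matrix C G /\
  exists (r : nat) (n' : 'I_r -> nat) (G' : forall j : 'I_r, 'M[L]_(k, n' j)),
    (forall j, (0 < n' j)%N) /\
    exists C' : {vspace 'rV[L]_(\sum_(i < t + r) cat_sizes n n' i)},
      [/\ generator_matrix C' (extend_matrix G G'),
          nondegenerate_code C' & one_weight C'].
Proof.
have [G gG] : exists G : 'M[L]_(k, \sum_(i < t) n i), generator_matrix C G.
  by rewrite -dimC; apply: generator_matrix_exists.
exists G; split=> //.
have nG := (nondegenerate_codeP gG).1 ndC.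
have [s us ms] := all_units L k.
(* Each pair [(A, i)] indexes one new block [A *m submxrow G i]. The identity is removed because the
   original blocks already account for it. *)
pose ps := [seq (A, i) | A <- rem 1%:M s, i <- enum 'I_t].
have psU (j : 'I_(size ps)) : (tnth (in_tuple ps) j).1 \in unitmx.
  case/allpairsP: (mem_tnth j (in_tuple ps)) => -[A i] /= [sA _ ->] /=.
  by rewrite -ms (mem_rem sA).
pose G' j := (tnth (in_tuple ps) j).1 *m submxrow G (tnth (in_tuple ps) j).2.
exists (size ps), (fun j => n (tnth (in_tuple ps) j).2), G'.
split=> [j|]; first exact: n_gt0.
pose E := extend_matrix G G'.
exists <<[seq row i E | i : 'I_k]>>%VS.
have gE : generator_matrix <<[seq row i E | i : 'I_k]>>%VS E.
  rewrite /generator_matrix /basis_of eqxx; apply/free_rows => u /extend_matrix_eq0.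
  by case/andP: gG => _ /free_rows; apply.
have weightE u : sumrank_weight (u *m E) =
    (\sum_(A <- s) \sum_(i < t) rk (u *m A *m submxrow G i))%N.
  (* The original blocks give the term [A = 1] of the sum over all units. *)
  rewrite sumrank_weight_extend (big_rem 1%:M) ?ms ?unitmx1 //= mulmx1.
  congr (_ + _)%N.
  (* The sum over positions in [ps] becomes a sum over its pairs, then a double sum over [A] and
     [i]. *)
  rewrite -(big_tnth _ _ _ xpredT (fun p => rk (u *m (p.1 *m submxrow G p.2)))).
  rewrite big_allpairs; apply: eq_bigr => A _; rewrite big_enum.
  by apply: eq_bigr => i _; rewrite mulmxA.
split=> //.
  apply/(nondegenerate_codeP gE) => i; rewrite mxrowK.
  apply: (cat_blocks_ind (P := fun p M => columns_free M)) => // j.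
  exact: columns_free_mul.
move=> x y /span_rowsP[u ->] /span_rowsP[v ->] u0 v0; rewrite !weightE.
pose f (w : 'rV[L]_k) := (\sum_(i < t) rk (w *m submxrow G i))%N.
(* The remaining goals ask for nonzero messages: a zero message would give the zero codeword. *)
apply: (sum_units_const f) => //.
  by apply: contraNneq u0 => ->; rewrite mul0mx.
by apply: contraNneq v0 => ->; rewrite mul0mx.
Qed.
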